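(* Let $\tau$ be a task with features $X=(X_1,\dots,X_d)$, potential feature values $X(1)$, missingness indicators $R\in\{0,1\}^d$ and target $Y$. For any subset $\underline X_t\subseteq X$ of acquired features (with realization $\underline x_t$) and any candidate feature $j$, the conditional mutual information $I_\tau(Y;X_j(1)\mid \underline X_t=\underline x_t)$ is identified whenever the reference distribution $P_\tau(X(1),Y)$ is identified. Moreover, suppose that (i) (Missing at random) $R_j\perp\!\!\!\perp X_j(1)\mid \underline X_t$; (ii) (No direct effect) $R_j\perp\!\!\!\perp Y\mid X_j(1),\underline X_t$; (iii) (Positivity) $P_\tau(R_j=1\mid \underline X_t=\underline x_t)>0$ for all values $\underline x_t$ and all $j\in\{1,\dots,d\}$. Then $$I_\tau\big(Y;X_j(1)\mid \underline X_t=\underline x_t\big)=I_\tau\big(Y;X_j\mid \underline X_t=\underline x_t,\,R_j=1\big).$$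
   Context: All random variables are defined on a common probability space with law $P_\tau$. $R_j\in\{0,1\}$ indicates whether feature $j$ is observed. $X_j(1)$ is the potential outcome of feature $j$, i.e. the value that would be observed had $R_j=1$. The realized feature is $X_j=X_j(1)$ if $R_j=1$, and $X_j=$ ''?'' (a missing symbol) if $R_j=0$. $\underline X_t$ denotes the collection of features acquired up to step $t$ (including always-observed baseline features), with realization $\underline x_t$ consisting of actual (non-missing) values. The reference distribution is $P_\tau(X(1),Y)$, the joint distribution in the absence of missingness. The conditional mutual information $I_\tau(Y;X_j(1)\mid\underline X_t=\underline x_t)$ is computed under the reference distribution, so the acquired features in $\underline X_t$ take their potential values there. The conditional mutual information at a fixed value $\underline x_t$ is $$I_\tau(Y;X_j\mid\underline X_t=\underline x_t)=\mathbb E_{X_j\mid \underline x_t}\big[D_{\mathrm{KL}}\big(P_\tau(Y\mid X_j,\underline x_t)\,\|\,P_\tau(Y\mid\underline x_t)\big)\big],$$ that is, the mutual information of $Y$ and $X_j$ under their joint conditional law given $\underline X_t=\underline x_t$. $I_\tau(Y;X_j\mid \underline X_t=\underline x_t,R_j=1)$ is the same quantity under the conditional law given $\underline X_t=\underline x_t$ and $R_j=1$. A quantity is ''identified'' if it is uniquely determined by the distribution of the observed data $(X,R,Y)$. *)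

(* Defs.v *)
From HB Require Import structures.
From mathcomp Require Import all_boot all_order all_algebra.
From mathcomp Require Import all_classical all_reals all_analysis.

Set Implicit Arguments.
Unset Strict Implicit.
Unset Printing Implicit Defensive.

Import Order.TTheory GRing.Theory Num.Theory.
Import numFieldNormedType.Exports.

Local Open Scope classical_set_scope.
Local Open Scope ring_scope.
Local Open Scope ereal_scope.

(* [option T] is the value space of a realized feature, [None] being the
   missing symbol "?".  It carries the disjoint-union sigma-algebra: [{None}] is
   measurable and the trace on [T] is the sigma-algebra of [T]. *)
Section option_measurable.
Context d (T : measurableType d).

Definition option_measurable : set (set (option T)) :=
  [set A | measurable (Some @^-1` A)].

Let option_measurable0 : option_measurable set0.
Proof. by rewrite /option_measurable /= preimage_set0. Qed.

Let option_measurableC A : option_measurable A -> option_measurable (~` A).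
Proof. by rewrite /option_measurable /= preimage_setC; exact: measurableC. Qed.

Let option_measurable_bigcup (F : (set (option T))^nat) :
  (forall i, option_measurable (F i)) -> option_measurable (\bigcup_i F i).
Proof.
by move=> mF; rewrite /option_measurable /= preimage_bigcup;
  exact: bigcupT_measurable.
Qed.

HB.instance Definition _ := @isMeasurable.Build d (option T) option_measurable
  option_measurable0 option_measurableC option_measurable_bigcup.

End option_measurable.

(* Dependent product of measurable spaces, with the product sigma-algebra. *)
Definition dprod_display (I : Type) : (I -> measure_display) -> measure_display.
Proof. exact (fun _ => default_measure_display). Qed.

Definition dprod (I : Type) (d : I -> measure_display)
  (T : forall i, measurableType (d i)) : Type := forall i, T i.

Section dprod_measurable.
Context (I : Type) (d : I -> measure_display)
  (T : forall i, measurableType (d i)).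

HB.instance Definition _ := Pointed.copy (dprod T) (forall i, T i).

Definition dprod_cylinders : set (set (dprod T)) :=
  \bigcup_(i in [set: I])
    preimage_set_system [set: dprod T] (fun f => f i) measurable.

HB.instance Definition _ := @isMeasurable.Build (dprod_display d) (dprod T)
  <<s dprod_cylinders >> (@sigma_algebra0 _ setT dprod_cylinders)
  (@sigma_algebraC (dprod T) dprod_cylinders)
  (@sigma_algebra_bigcup _ setT dprod_cylinders).

Lemma measurable_dprodP d0 (O : measurableType d0) (f : O -> dprod T) :
  (forall i, measurable_fun [set: O] (fun w => f w i)) ->
  measurable_fun [set: O] f.
Proof.
move=> mf; apply: (measurability dprod_cylinders) => //.
move=> _ [_ [i _ [B mB <-]] <-]; rewrite !setTI.
by have := mf i measurableT B mB; rewrite setTI.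
Qed.

End dprod_measurable.

Section random_elements.
Context dO (O : measurableType dO).

Definition rv_pair d1 d2 (T1 : measurableType d1) (T2 : measurableType d2)
  (f : {mfun O >-> T1}) (g : {mfun O >-> T2}) : O -> T1 * T2 :=
  fun w => (f w, g w).

HB.instance Definition _ d1 d2 (T1 : measurableType d1)
  (T2 : measurableType d2) (f : {mfun O >-> T1}) (g : {mfun O >-> T2}) :=
  isMeasurableFun.Build _ _ _ _ (rv_pair f g)
    (measurable_fun_pair (measurable_funPT f) (measurable_funPT g)).

Definition rv_family (I : Type) (d : I -> measure_display)
  (T : forall i, measurableType (d i)) (f : forall i, {mfun O >-> T i}) :
  O -> dprod T := fun w i => f i w.

Lemma measurable_rv_family (I : Type) (d : I -> measure_display)
  (T : forall i, measurableType (d i)) (f : forall i, {mfun O >-> T i}) :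
  measurable_fun [set: O] (rv_family f).
Proof. by apply: measurable_dprodP => i; exact: measurable_funPT. Qed.

HB.instance Definition _ (I : Type) (d : I -> measure_display)
  (T : forall i, measurableType (d i)) (f : forall i, {mfun O >-> T i}) :=
  isMeasurableFun.Build _ _ _ _ (rv_family f) (measurable_rv_family f).

End random_elements.

(* The measure at a point of a probability kernel, packaged as a probability. *)
Section kernel_at.
Context d d' (X : measurableType d) (Y : measurableType d') (R : realType).

Definition kernel_at (k : R.-pker X ~> Y) (x : X) : set Y -> \bar R := k x.

HB.instance Definition _ (k : R.-pker X ~> Y) (x : X) :=
  Measure.on (kernel_at k x).
HB.instance Definition _ (k : R.-pker X ~> Y) (x : X) :=
  Measure_isProbability.Build _ _ _ (kernel_at k x) (prob_kernel x).

End kernel_at.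

Definition kl_divergence d (T : measurableType d) (R : realType)
  (mu nu : probability T R) : \bar R :=
  if `[< mu `<< nu >]
  then \int[mu]_t lne (Radon_Nikodym (charge_of_finite_measure mu) nu t)
  else +oo.

(* Holds for every standard Borel space.  It makes regular conditional
   distributions a.e. unique as measures, not only event by event. *)
Definition countably_generated d (T : measurableType d) : Prop :=
  exists G : nat -> set T, @measurable d T = <<s range G >>.

Section conditioning.
Context dO (O : measurableType dO) (R : realType) (P : probability O R).

(* [g] is a version of [w |-> P(E | W = w)]. *)
Definition is_cond_prob dW (TW : measurableType dW) (W : {mfun O >-> TW})
  (E : set O) (g : TW -> \bar R) : Prop :=
  (distribution P W).-integrable [set: TW] g /\
  forall C, measurable C ->
    \int[distribution P W]_(w in C) g w = P (E `&` W @^-1` C).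

(* [k] is a regular conditional distribution of [V] given [W]. *)
Definition is_cond_law dV dW (TV : measurableType dV) (TW : measurableType dW)
  (V : {mfun O >-> TV}) (W : {mfun O >-> TW}) (k : R.-pker TW ~> TV) : Prop :=
  forall B, measurable B -> is_cond_prob W (V @^-1` B) (k ^~ B).

(* Conditional independence of [U] and [V] given [W].  Versions of conditional
   probabilities exist and are a.e. unique, so that quantifying universally
   over them is immaterial. *)
Definition cond_indep dU dV dW (TU : measurableType dU)
  (TV : measurableType dV) (TW : measurableType dW)
  (U : {mfun O >-> TU}) (V : {mfun O >-> TV}) (W : {mfun O >-> TW}) : Prop :=
  forall A B, measurable A -> measurable B ->
  forall gU gV gUV : TW -> \bar R,
    is_cond_prob W (U @^-1` A) gU ->
    is_cond_prob W (V @^-1` B) gV ->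
    is_cond_prob W (U @^-1` A `&` V @^-1` B) gUV ->
    \forall w \ae distribution P W, gUV w = gU w * gV w.

(* [I] is a version of the function
     [z |-> I(Y; X | Z = z) = E_{X|z} [KL(P(Y | X, z) || P(Y | z))]];
   like the conditional laws, it is determined by [P] up to a null set of
   values [z]. *)
Definition is_cond_mutual_info dY dX dZ (TY : measurableType dY)
  (TX : measurableType dX) (TZ : measurableType dZ)
  (Y : {mfun O >-> TY}) (X : {mfun O >-> TX}) (Z : {mfun O >-> TZ})
  (I : TZ -> \bar R) : Prop :=
  exists (kX : R.-pker TZ ~> TX) (kYX : R.-pker (TX * TZ)%type ~> TY)
         (kY : R.-pker TZ ~> TY),
  [/\ is_cond_law X Z kX,
      is_cond_law Y (rv_pair X Z) kYX,
      is_cond_law Y Z kY &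
      forall z, I z = \int[kernel_at kX z]_x
        kl_divergence (kernel_at kYX (x, z)) (kernel_at kY z)].

End conditioning.

Section tasks.
Context (R : realType) (n : nat).
Context (dT : 'I_n -> measure_display) (T : forall k, measurableType (dT k)).
Context dY (TY : measurableType dY).

Record task := Task {
  task_display : measure_display;
  task_space : measurableType task_display;
  task_law : probability task_space R;
  potential : forall k : 'I_n, {mfun task_space >-> T k};
  observed : 'I_n -> {mfun task_space >-> bool};
  target : {mfun task_space >-> TY} }.

Section task_variables.
Variable tau : task.

Definition realized (k : 'I_n) : task_space tau -> option (T k) :=
  fun w => if observed tau k w then Some (potential tau k w) else None.

Lemma measurable_realized k : measurable_fun [set: task_space tau] (realized k).
Proof.
move=> _ B mB; rewrite setTI.
have mR b : measurable (observed tau k @^-1` [set b]).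
  by rewrite -[_ @^-1` _]setTI; exact: measurable_funPT.
have mX : measurable (potential tau k @^-1` (Some @^-1` B)).
  by rewrite -[_ @^-1` _]setTI; exact: measurable_funPT.
have mN : measurable [set w : task_space tau | B None].
  have [BN|BN] := pselect (B None).
    by rewrite (_ : [set _ | _] = setT)//; apply/seteqP; split.
  by rewrite (_ : [set _ | _] = set0)//; apply/seteqP; split.
rewrite (_ : _ @^-1` B =
  (observed tau k @^-1` [set true] `&` potential tau k @^-1` (Some @^-1` B)) `|`
  (observed tau k @^-1` [set false] `&` [set w | B None])).
  by apply: measurableU; exact: measurableI.
apply/seteqP; split => w; rewrite /realized /=.
  by case: (observed tau k w) => Bw; [left|right].
by case=> -[-> ].
Qed.

HB.instance Definition _ k :=
  isMeasurableFun.Build _ _ _ _ (realized k) (@measurable_realized k).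

(* The acquired features indexed by [A].  They take their potential values, also
   in the conditions below and in the conditional mutual information given
   [R_j = 1]: conditioning on realized values would moreover restrict to
   [R_k = 1] for all [k] in [A], which the reference distribution does not. *)
Definition acquired (A : {set 'I_n}) :
  {mfun task_space tau >-> dprod (fun k : {k : 'I_n | k \in A} => T (val k))} :=
  rv_family (fun k : {k : 'I_n | k \in A} => potential tau (val k)).

Definition reference_data :
  {mfun task_space tau >-> (dprod T * TY)%type} :=
  rv_pair (rv_family (potential tau)) (target tau).

Definition observed_data :
  {mfun task_space tau >->
    (dprod (fun k => option (T k)) * dprod (fun _ : 'I_n => bool) * TY)%type} :=
  rv_pair (rv_pair (rv_family realized) (rv_family (observed tau)))
    (target tau).

Definition potential_cmi (A : {set 'I_n}) (j : 'I_n) :=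
  is_cond_mutual_info (task_law tau) (target tau) (potential tau j)
    (acquired A).

(* [I (x, true)] is the conditional mutual information given [x] and [R_j = 1]. *)
Definition observed_cmi (A : {set 'I_n}) (j : 'I_n) :=
  is_cond_mutual_info (task_law tau) (target tau) (realized j)
    (rv_pair (acquired A) (observed tau j)).

Definition missing_at_random (A : {set 'I_n}) (j : 'I_n) :=
  cond_indep (task_law tau) (observed tau j) (potential tau j) (acquired A).

Definition no_direct_effect (A : {set 'I_n}) (j : 'I_n) :=
  cond_indep (task_law tau) (observed tau j) (target tau)
    (rv_pair (potential tau j) (acquired A)).

Definition positivity (A : {set 'I_n}) :=
  forall (k : 'I_n) g,
    is_cond_prob (task_law tau) (acquired A) (observed tau k @^-1` [set true]) g ->
    \forall x \ae distribution (task_law tau) (acquired A), 0 < g x.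

End task_variables.

Arguments potential_cmi : clear implicits.
Arguments observed_cmi : clear implicits.
Arguments missing_at_random : clear implicits.
Arguments no_direct_effect : clear implicits.
Arguments positivity : clear implicits.

Definition same_observed_law (tau tau' : task) :=
  forall E, measurable E ->
    distribution (task_law tau) (observed_data tau) E =
    distribution (task_law tau') (observed_data tau') E.

Definition same_reference_law (tau tau' : task) :=
  forall E, measurable E ->
    distribution (task_law tau) (reference_data tau) E =
    distribution (task_law tau') (reference_data tau') E.

(* One direction of the a.e. condition suffices: it is used for all ordered
   pairs of tasks of a model. *)
Definition same_potential_cmi (A : {set 'I_n}) (j : 'I_n) (tau tau' : task) :=
  forall I I', potential_cmi tau A j I -> potential_cmi tau' A j I' ->
    \forall x \ae distribution (task_law tau) (acquired tau A), I x = I' x.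

(* A quantity, given by when two tasks agree on it, is identified in the model
   [M] if it is determined there by the law of the observed data. *)
Definition identified (M : task -> Prop) (same : task -> task -> Prop) :=
  forall tau tau', M tau -> M tau' ->
    same_observed_law tau tau' -> same tau tau'.

End tasks.

Arguments potential_cmi {R n dT T dY TY} tau A j I.
Arguments observed_cmi {R n dT T dY TY} tau A j I.
Arguments missing_at_random {R n dT T dY TY} tau A j.
Arguments no_direct_effect {R n dT T dY TY} tau A j.
Arguments positivity {R n dT T dY TY} tau A.
Arguments same_reference_law {R n dT T dY TY} tau tau'.

(* Main.v *)
(* The conditional mutual information is a functional of three conditional laws,
   each determined almost everywhere by the joint law of (Y, X, Z) because the
   value spaces are countably generated; this gives the first claim.

   For the second one, let Q = P(. | R_j = 1).  Missingness at random says that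
   the law of X_j(1) given Z is the same under P and Q, and no direct effect that
   the law of Y given (X_j(1), Z) is; averaging, so is the law of Y given Z.
   Hence the reference information is also an information under Q.  Under Q the
   realized feature is almost surely Some X_j(1), and the conditional laws given
   (Z, R_j) become laws given Z after substituting R_j = 1.  Uniqueness under Q
   gives the identity for Q-almost every value of Z, hence by positivity for
   P-almost every one. *)

Require Import Defs.
From HB Require Import structures.
From mathcomp Require Import all_boot all_order all_algebra.
From mathcomp Require Import all_classical all_reals all_analysis measurable_realfun.

Local Open Scope classical_set_scope.
Local Open Scope ring_scope.
Local Open Scope ereal_scope.

Set Implicit Arguments.
Unset Strict Implicit.
Unset Printing Implicit Defensive.
Import Order.TTheory GRing.Theory Num.Theory.
Import numFieldNormedType.Exports.

(** * Transfer of integrals along an injective map *)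

Section nnsfun_composition.
Import HBNNSimple.

Lemma nnsfun_comp d1 d2 (T1 : measurableType d1) (T2 : measurableType d2)
  (R : realType) (psi : T2 -> T1) (h : {nnsfun T1 >-> R}) :
  measurable_fun [set: T2] psi ->
  exists h' : {nnsfun T2 >-> R}, forall y, h' y = h (psi y).
Proof.
move=> mpsi.
have mh : measurable_fun [set: T2] (h \o psi) by exact: measurableT_comp.
have fh : finite_set (range (h \o psi)).
  apply: (sub_finite_set _ (fimfunP h)) => _ [x _ <-]; by exists (psi x).
have nh x : (0 <= (h \o psi) x)%R by exact: fun_ge0.
pose hm := isMeasurableFun.Build _ _ _ _ _ mh.
pose hf := FiniteImage.Build _ _ _ fh.
pose hn := isNonNegFun.Build _ _ _ nh.
pose h' : {nnsfun T2 >-> R} := HB.pack (h \o psi) hm hf hn.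
by exists h'.
Qed.

End nnsfun_composition.

(* The integrands below need not be measurable: an integral only depends on the
   simple functions below the positive and negative parts of the integrand, and
   these can be moved along [phi], up to a null set, in both directions. *)
Section integral_transfer.
Import HBNNSimple.
Context d1 d2 (T1 : measurableType d1) (T2 : measurableType d2) (R : realType).
Context (mu : {measure set T1 -> \bar R}) (nu : {measure set T2 -> \bar R}).
Context (phi : T1 -> T2) (psi : T2 -> T1).
Hypotheses (mphi : measurable_fun [set: T1] phi)
  (mpsi : measurable_fun [set: T2] psi) (mrange : measurable (range phi))
  (phiK : cancel phi psi)
  (nuE : forall B, measurable B -> nu B = mu (phi @^-1` B)).

Let sintegral_transferl (g : T1 -> \bar R) (g' : T2 -> \bar R)
    (h : {nnsfun T1 >-> R}) :
  (forall y, 0 <= g' y) -> (\forall x \ae mu, g x = g' (phi x)) ->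
  (forall x, (h x)%:E <= g x) ->
  exists2 h' : {nnsfun T2 >-> R}, forall y, (h' y)%:E <= g' y &
    sintegral nu h' = sintegral mu h.
Proof.
move=> g'0 [N [mN N0 gN]] hg.
have [h1 h1E] := nnsfun_comp h mpsi.
(* Over [N] and off the range of [phi] nothing relates [h \o psi] to [g'], so it is cut down to 0
   there. Pulled back along [phi], the cut removes only the null set [N]. *)
have mD : measurable (range phi `&` psi @^-1` (~` N)).
  apply: measurableI => //; rewrite -[X in measurable X]setTI.
  by apply: mpsi => //; exact: measurableC.
exists (proj_nnsfun h1 mD).
  move=> y /=; rewrite mindicE; case: (boolP (_ \in _)) => [|_]; last by rewrite mulr0.
  rewrite inE => -[[x _ <-]] /=; rewrite phiK mulr1 h1E phiK => Nx.
  have <- : g x = g' (phi x) by apply: contrapT => /gN.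
  exact: hg.
rewrite -!integralT_nnsfun.
rewrite (eq_measure_integral (pushforward mu phi)) => [|A mA _]; last exact: nuE.
rewrite [LHS]ge0_integral_pushforward//.
- rewrite preimage_setT.
  apply: ae_eq_integral => //.
  + by apply: measurableT_comp => //; exact/measurable_EFinP.
  + exact/measurable_EFinP.
  + exists N; split => // x; apply: contra_notP => Nx _ /=.
    rewrite mindicE mem_set ?mulr1 ?h1E ?phiK//.
    by split; [exists x|rewrite /= phiK].
- exact/measurable_EFinP.
- by move=> y _; rewrite lee_fin.
Qed.

Let sintegral_transferr (g : T1 -> \bar R) (g' : T2 -> \bar R)
    (h : {nnsfun T2 >-> R}) :
  (forall x, 0 <= g x) -> (\forall x \ae mu, g x = g' (phi x)) ->
  (forall x, (h x)%:E <= g' x) ->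
  exists2 h' : {nnsfun T1 >-> R}, forall y, (h' y)%:E <= g y &
    sintegral mu h' = sintegral nu h.
Proof.
move=> g0 [N [mN N0 gN]] hg.
have [h1 h1E] := nnsfun_comp h mphi.
(* In this direction every point has an image under [phi], so only [N] is cut away. *)
have mD : measurable (~` N) by exact: measurableC.
exists (proj_nnsfun h1 mD).
  move=> y /=; rewrite mindicE; case: (boolP (_ \in _)) => [|_]; last by rewrite mulr0.
  rewrite inE mulr1 h1E => Ny.
  have -> : g y = g' (phi y) by apply: contrapT => /gN.
  exact: hg.
rewrite -!integralT_nnsfun.
rewrite [RHS](eq_measure_integral (pushforward mu phi)) => [|A mA _]; last exact: nuE.
rewrite [RHS]ge0_integral_pushforward//.
- rewrite preimage_setT.
  apply: ae_eq_integral => //.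
  + exact/measurable_EFinP.
  + by apply: measurableT_comp => //; exact/measurable_EFinP.
  + exists N; split => // x; apply: contra_notP => Nx _ /=.
    by rewrite mindicE mem_set ?mulr1 ?h1E.
- exact/measurable_EFinP.
- by move=> y _; rewrite lee_fin.
Qed.

Lemma ae_integral_transfer (f : T1 -> \bar R) (f' : T2 -> \bar R) :
  (\forall x \ae mu, f x = f' (phi x)) ->
  \int[mu]_x f x = \int[nu]_y f' y.
Proof.
move=> ff'; rewrite /integral !patch_setT; congr (ereal_sup _ - ereal_sup _).
- have gg : \forall x \ae mu, f^\+ x = f'^\+ (phi x).
    by apply: filterS ff' => x; rewrite !funeposE => ->.
  apply/seteqP; split => _ [h /= hf <-].
    by have [//|h' ? <-] := sintegral_transferl _ gg hf; exists h'.
  by have [//|h' ? <-] := sintegral_transferr _ gg hf; exists h'.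
- have gg : \forall x \ae mu, f^\- x = f'^\- (phi x).
    by apply: filterS ff' => x; rewrite !funenegE => ->.
  apply/seteqP; split => _ [h /= hf <-].
    by have [//|h' ? <-] := sintegral_transferl _ gg hf; exists h'.
  by have [//|h' ? <-] := sintegral_transferr _ gg hf; exists h'.
Qed.

End integral_transfer.

(** * Divergence up to equality on measurable sets, and countably generated spaces *)

(** Agreement on measurable sets is not equality of the packaged measures, so nothing can be
    rewritten inside the Radon-Nikodym derivative. The two derivatives have the same integrals over
    measurable sets, hence agree [nu]-a.e. and, by domination, [mu]-a.e.; the integral is then
    transferred along the identity. *)
Lemma eq_kl_divergence d (T : measurableType d) (R : realType)
  (mu nu mu' nu' : probability T R) :
  (forall B, measurable B -> mu B = mu' B) ->
  (forall B, measurable B -> nu B = nu' B) ->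
  kl_divergence mu nu = kl_divergence mu' nu'.
Proof.
move=> mumu' nunu'; rewrite /kl_divergence.
have domE : (mu `<< nu) = (mu' `<< nu').
  apply/propext; split => /null_content_dominatesP H;
    apply/null_content_dominatesP => A mA.
    move=> nuA; apply: etrans (H A mA (etrans (nunu' A mA) nuA)).
    exact: esym (mumu' A mA).
  move=> nuA; apply: etrans (H A mA (etrans (esym (nunu' A mA)) nuA)).
  exact: mumu'.
rewrite domE; case: ifPn => // /asboolP dom'.
have dom : mu `<< nu by rewrite domE.
apply: (@ae_integral_transfer _ _ _ _ _ mu mu' idfun idfun) => //.
- exact: measurable_id.
- exact: measurable_id.
- by rewrite image_id.
- by move=> B /mumu'.
suff : \forall x \ae nu, Radon_Nikodym (charge_of_finite_measure mu) nu x =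
    Radon_Nikodym (charge_of_finite_measure mu') nu' x.
  move=> [N [mN N0 H]]; exists N; split => //.
    by move/null_content_dominatesP : dom; exact.
  by apply: subset_trans H; apply: subsetC => x /= ->.
suff : ae_eq nu setT (Radon_Nikodym (charge_of_finite_measure mu) nu)
    (Radon_Nikodym (charge_of_finite_measure mu') nu').
  by apply: filterS => x; exact.
apply: integral_ae_eq => //.
- exact: Radon_Nikodym_integrable.
move=> E _ mE; rewrite -Radon_Nikodym_integral//.
rewrite (@eq_measure_integral _ _ _ _ nu')=> [|A mA _]; last exact: nunu'.
rewrite -Radon_Nikodym_integral//.
exact: mumu'.
Qed.

(** Finite intersections of the generators form a countable pi-system, so a single null set serves
    for all of them; off it, the two probabilities agree on a generating pi-system and hence on
    every measurable set. *)
Lemma ae_eq_probability d d' (W : measurableType d) (T : measurableType d')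
  (R : realType) (mu : {measure set W -> \bar R}) (k1 k2 : W -> probability T R) :
  countably_generated T ->
  (forall B, measurable B -> \forall w \ae mu, k1 w B = k2 w B) ->
  \forall w \ae mu, forall B, measurable B -> k1 w B = k2 w B.
Proof.
move=> [G GE] k12.
pose pi (s : seq nat) := \big[setI/setT]_(i <- s) G i.
have mG i : measurable (G i) by rewrite GE; apply: sub_sigma_algebra; exists i.
have mpi s : measurable (pi s) by exact: bigsetI_measurable.
have piE : @measurable _ T = <<s range pi >>.
  rewrite GE; apply/seteqP; split.
    apply: smallest_sub; first exact: smallest_sigma_algebra.
    move=> _ [i _ <-]; apply: sub_sigma_algebra.
    by exists [:: i] => //; rewrite /pi big_seq1.
  rewrite -GE; apply: smallest_sub; first exact: sigma_algebra_measurable.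
  by move=> _ [s _ <-].
(* Finite sequences are coded by natural numbers so that the a.e. quantifier commutes with a
   countable one. *)
have : \forall w \ae mu, forall n s, unpickle n = Some s -> k1 w (pi s) = k2 w (pi s).
  apply/ae_foralln => n; case: (unpickle n) => [s|]; last exact: aeW.
  by apply: filterS (k12 _ (mpi s)) => w k12w _ [<-].
apply: filterS => w k12w B mB.
apply: (measure_unique (range pi) (fun=> setT)) => //.
- move=> _ _ [s _ <-] [t _ <-]; exists (s ++ t) => //.
  by rewrite /pi big_cat.
- by move=> _; exists [::] => //; rewrite /pi big_nil.
- by rewrite bigcup_const//; exists 0%N.
- by move=> _ [s _ <-]; exact: (k12w (pickle s)) (pickleK s).
- by move=> _; rewrite [ltLHS]probability_setT ltry.
Qed.

(** The generators are moved through [Some], and [[set None]] is added. The sets of [T] whose image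
    is generated form a sigma-algebra: a complement in [T] becomes the complement of the image
    together with [None]. *)
Lemma countably_generated_option d (T : measurableType d) :
  countably_generated T -> countably_generated (option T).
Proof.
move=> [G GE].
pose G' n : set (option T) := if n is i.+1 then Some @` G i else [set None].
exists G'.
have mSome (B : set T) : measurable B -> measurable (Some @` B : set (option T)).
  move=> mB; rewrite /measurable/= /option_measurable/=.
  by rewrite (_ : _ @^-1` _ = B)//; apply/seteqP; split => [x [y By [<-]]|x Bx]//=; exists x.
apply/seteqP; split; last first.
  apply: smallest_sub; first exact: sigma_algebra_measurable.
  move=> _ [[|i] _ <-].
    rewrite /measurable/= /option_measurable/=.
    by rewrite (_ : _ @^-1` _ = set0)//; apply/seteqP; split.
  by apply: mSome; rewrite GE; apply: sub_sigma_algebra; exists i.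
set H := range G'.
have sH := smallest_sigma_algebra [set: option T] H.
have HN : <<s H >> [set None] by apply: sub_sigma_algebra; exists 0%N.
have HU A B : <<s H >> A -> <<s H >> B -> <<s H >> (A `|` B).
  move=> HA HB; exact: (@measurableU _ (g_sigma_algebraType H)).
have HC A : <<s H >> A -> <<s H >> (~` A).
  by move=> HA; exact: (@measurableC _ (g_sigma_algebraType H)).
have Hsome (B : set T) : measurable B -> <<s H >> (Some @` B).
  rewrite GE; move: B; apply: smallest_sub; last first.
    by move=> _ [i _ <-]; apply: sub_sigma_algebra; exists i.+1.
  split => /=.
  - by rewrite image_set0; exact: (@measurable0 _ (g_sigma_algebraType H)).
  - move=> A HA; rewrite setTD (_ : _ @` _ = ~` (Some @` A `|` [set None])).
      by apply: HC; exact: HU.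
    apply/seteqP; split => [_ [x nAx <-] [[y Ay [yx]]|//]|[x nx|]].
    + by apply: nAx; rewrite -yx.
    + by exists x => // Ax; apply: nx; left; exists x.
    + by move=> nN; exfalso; apply: nN; right.
  - move=> F HF; rewrite image_bigcup.
    by apply: (@bigcupT_measurable _ (g_sigma_algebraType H)).
move=> B mB.
have -> : B = (Some @` (Some @^-1` B)) `|` (B `&` [set None]).
  apply/seteqP; split => [[x|] Bx|x [[y By <-]//|[]//]].
    by left; exists x.
  by right.
apply: HU; first exact: Hsome.
have [BN|BN] := pselect (B None).
  by rewrite (_ : _ `&` _ = [set None])//; apply/seteqP; split=> [x []//|x ->].
rewrite (_ : _ `&` _ = set0); first exact: (@measurable0 _ (g_sigma_algebraType H)).
by apply/seteqP; split=> [x [+ xN]|//]; rewrite xN.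
Qed.

(** * Operations on probability kernels *)

Lemma probability_integrable_le1 d (T : measurableType d) (R : realType)
  (mu : probability T R) (D : set T) (f : T -> \bar R) :
  measurable D -> measurable_fun [set: T] f -> (forall x, 0 <= f x <= 1) ->
  mu.-integrable D f.
Proof.
move=> mD mf f01; apply/integrableP; split; first exact: measurable_funTS.
apply: (@le_lt_trans _ _ (\int[mu]_(x in D) cst 1 x)).
  apply: ge0_le_integral => //.
    by apply: measurableT_comp => //; exact: measurable_funTS.
  by move=> x _; have /andP[f0 f1] := f01 x; rewrite gee0_abs.
by rewrite integral_cst// mul1e (le_lt_trans (probability_le1 _ _)) ?ltry.
Qed.

Section probability_kernel_operations.
Context d d' d'' (X : measurableType d) (Y : measurableType d')
  (Z : measurableType d'') (R : realType).

Lemma kernel_le1 (k : R.-pker X ~> Y) x B : measurable B -> k x B <= 1.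
Proof.
move=> mB; rewrite -(prob_kernel (s:=k) x).
by apply: le_measure => //; rewrite inE.
Qed.

Lemma integrable_kernel (mu : probability X R) (k : R.-pker X ~> Y) B :
  measurable B -> mu.-integrable [set: X] (k ^~ B).
Proof.
move=> mB; apply: probability_integrable_le1 => //; first exact: measurable_kernel.
by move=> x; rewrite measure_ge0 kernel_le1.
Qed.

(** The proof [ms] is an argument so that the kernel structures declared below can be inferred from
    the term alone. *)
Definition kernel_precomp (k : R.-pker Y ~> Z) (s : X -> Y)
  (ms : measurable_fun [set: X] s) : X -> {measure set Z -> \bar R} :=
  fun x => k (s x).

Section kernel_precomp_instances.
Context (k : R.-pker Y ~> Z) (s : X -> Y) (ms : measurable_fun [set: X] s).

Let measurable_kernel_precomp U : measurable U ->
  measurable_fun [set: X] (kernel_precomp k ms ^~ U).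
Proof.
by move=> mU; exact: (measurableT_comp (measurable_kernel k U mU)).
Qed.

HB.instance Definition _ :=
  isKernel.Build _ _ X Z R (kernel_precomp k ms) measurable_kernel_precomp.

HB.instance Definition _ := Kernel_isProbability.Build _ _ X Z R
  (kernel_precomp k ms) (fun x => prob_kernel (s:=k) (s x)).
End kernel_precomp_instances.

Definition kernel_map (k : R.-pker X ~> Y) (phi : {mfun Y >-> Z}) :
  X -> {measure set Z -> \bar R} :=
  fun x => distribution (kernel_at k x) phi.

Section kernel_map_instances.
Context (k : R.-pker X ~> Y) (phi : {mfun Y >-> Z}).

Let measurable_kernel_map U : measurable U ->
  measurable_fun [set: X] (kernel_map k phi ^~ U).
Proof.
move=> mU; apply: (measurable_kernel k).
by rewrite -[X in measurable X]setTI; exact: measurable_funPT.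
Qed.

HB.instance Definition _ :=
  isKernel.Build _ _ X Z R (kernel_map k phi) measurable_kernel_map.

Let kernel_map1 x : kernel_map k phi x setT = 1.
Proof. exact: probability_setT. Qed.

HB.instance Definition _ := Kernel_isProbability.Build _ _ X Z R
  (kernel_map k phi) kernel_map1.
End kernel_map_instances.

End probability_kernel_operations.

Lemma measurable_preimage d d' (X : measurableType d) (Y : measurableType d')
  (f : {mfun X >-> Y}) B : measurable B -> measurable (f @^-1` B).
Proof.
by move=> mB; rewrite -[X in measurable X]setTI; exact: measurable_funPT.
Qed.

(** * Versions of conditional probabilities and laws *)

Section conditional_probability.
Context dO (O : measurableType dO) (R : realType) (P : probability O R).
Context dW (TW : measurableType dW) (W : {mfun O >-> TW}).

Lemma cond_prob_unique E g g' :
  is_cond_prob P W E g -> is_cond_prob P W E g' ->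
  \forall w \ae distribution P W, g w = g' w.
Proof.
move=> [ig gE] [ig' g'E].
have : ae_eq (distribution P W) setT g g'.
  apply: integral_ae_eq => //; first exact: measurable_int ig'.
  by move=> C _ mC; rewrite gE// g'E.
by apply: filterS => w; exact.
Qed.

(** Integrability is automatic because the values of a probability kernel lie between 0 and 1. *)
Lemma cond_lawP dV (TV : measurableType dV) (V : {mfun O >-> TV})
    (k : R.-pker TW ~> TV) :
  is_cond_law P V W k <->
  forall B C, measurable B -> measurable C ->
    \int[distribution P W]_(w in C) k w B = P (V @^-1` B `&` W @^-1` C).
Proof.
split=> [H B C mB mC|H B mB]; first by have [_ ->] := H B mB.
by split=> [|C mC]; [exact: integrable_kernel|exact: H].
Qed.

End conditional_probability.

(** The identities of [cond_lawP] involve the joint law of [V] and [W] only through rectangles; the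
    law of [W] is the case where the first side is [setT]. *)
Lemma cond_law_transfer dO dO' (O : measurableType dO) (O' : measurableType dO')
  (R : realType) (P : probability O R) (P' : probability O' R)
  dV dW (TV : measurableType dV) (TW : measurableType dW)
  (V : {mfun O >-> TV}) (W : {mfun O >-> TW})
  (V' : {mfun O' >-> TV}) (W' : {mfun O' >-> TW}) (k : R.-pker TW ~> TV) :
  (forall E, measurable E -> distribution P (rv_pair V W) E =
    distribution P' (rv_pair V' W') E) ->
  is_cond_law P' V' W' k -> is_cond_law P V W k.
Proof.
move=> PP' /cond_lawP H; apply/cond_lawP => B C mB mC.
have -> : P (V @^-1` B `&` W @^-1` C) = P' (V' @^-1` B `&` W' @^-1` C).
  exact: (PP' (B `*` C) (measurableX mB mC)).
rewrite -H//; apply: eq_measure_integral => A mA _.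
have : P (setT `&` W @^-1` A) = P' (setT `&` W' @^-1` A).
  exact: PP' (setT `*` A) (measurableX measurableT mA).
by rewrite !setTI.
Qed.

(** * Conditioning on an event of positive probability *)

Section conditioning_on_event.
Context dO (O : measurableType dO) (R : realType) (P : probability O R).
Context (F : set O) (mF : measurable F) (PF : P F != 0).

(** The last argument [P] is the fallback when [F] is null, which makes this a probability without
    any hypothesis on [F]. *)
Definition given : set O -> \bar R := mnormalize (mrestr P mF) P.

HB.instance Definition _ := Probability.on given.

Lemma givenE A : given A = P (A `&` F) * (fine (P F))^-1%:E.
Proof.
rewrite /given /mnormalize/= /mrestr setTI (negbTE PF)/=.
by rewrite -[_ == _]negbK -ltey ltey_eq fin_num_measure.
Qed.

Lemma fine_event_gt0 : (0 < fine (P F))%R.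
Proof. by rewrite fine_gt0// lt0e PF measure_ge0/= ltey_eq fin_num_measure. Qed.

Lemma mul_given A : P F * given A = P (A `&` F).
Proof.
rewrite givenE -{1}(@fineK _ (P F)) ?fin_num_measure// muleCA -EFinM.
by rewrite divff ?mule1// gt_eqF// fine_event_gt0.
Qed.

Context dW (TW : measurableType dW) (W : {mfun O >-> TW}).

Lemma given_dominates : distribution given W `<< distribution P W.
Proof.
apply/null_content_dominatesP => A mA; rewrite /distribution /pushforward => PA0.
apply: etrans (givenE _) _; apply/eqP; rewrite mule_eq0; apply/orP; left.
have mWA : measurable (W @^-1` A) by exact: measurable_preimage.
rewrite -measure_le0 -[leRHS](PA0 : P (W @^-1` A) = 0).
by apply: le_measure; rewrite ?inE//; exact: measurableI.
Qed.

Let dens := Radon_Nikodym (charge_of_finite_measure (distribution given W))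
  (distribution P W).

Let PFE : P F = (fine (P F))%:E.
Proof. by rewrite fineK// fin_num_measure. Qed.

Let idens : (distribution P W).-integrable setT dens.
Proof. by apply: Radon_Nikodym_integrable; exact: given_dominates. Qed.

(** Bayes' formula: over [C] the density integrates to the conditional probability of [W] being in
    [C], and the factor [P F] undoes the normalization. *)
Lemma is_cond_prob_Radon_Nikodym : is_cond_prob P W F (fun w => P F * dens w).
Proof.
rewrite PFE; split; first exact: integrableZl.
move=> C mC; rewrite integralZl//; last exact: integrableS idens.
rewrite -PFE -Radon_Nikodym_integral//; last exact: given_dominates.
by rewrite setIC -mul_given.
Qed.

Lemma integral_given p f C : is_cond_prob P W F p ->
  measurable_fun setT f -> (forall w, 0 <= f w <= 1) -> measurable C ->
  P F * \int[distribution given W]_(w in C) f w =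
  \int[distribution P W]_(w in C) (p w * f w).
Proof.
move=> pF mf f01 mC.
have f_le1 w : `|f w| <= 1 by have /andP[f0 f1] := f01 w; rewrite gee0_abs.
have intf : (distribution given W).-integrable C f.
  exact: probability_integrable_le1.
have ifd : (distribution P W).-integrable C (f \* dens).
  apply: (@le_integrable _ _ _ _ _ mC _ dens); last exact: integrableS idens.
  - apply: measurable_funTS; apply: emeasurable_funM => //.
    exact: measurable_int idens.
  - by move=> w _; rewrite abseM -[leRHS]mul1e lee_wpmul2r.
rewrite -(Radon_Nikodym_change_of_variables given_dominates mC intf).
rewrite PFE -integralZl//.
apply: ae_eq_integral => //.
- by apply: measurable_funeM; exact: measurable_int ifd.
- apply: measurable_funTS; apply: emeasurable_funM => //.
  by case: pF => /measurable_int.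
- apply: filterS (cond_prob_unique is_cond_prob_Radon_Nikodym pF) => w dp _.
  by rewrite -dp -PFE -muleA (muleC (dens w)).
Qed.

(** Criterion for a kernel to survive conditioning on [F]. Multiplied by the positive finite number
    [P F], the identity to prove becomes, through [integral_given], the assumed formula for the
    joint event. *)
Lemma cond_law_given dV (TV : measurableType dV) (V : {mfun O >-> TV})
    (k : R.-pker TW ~> TV) p : is_cond_prob P W F p ->
  (forall B, measurable B ->
    is_cond_prob P W (F `&` V @^-1` B) (fun w => p w * k w B)) ->
  is_cond_law given V W k.
Proof.
move=> pF pk; apply/cond_lawP => B C mB mC.
have cancelPF x y : P F * x = P F * y -> x = y.
  move=> /(congr1 (fun x => (fine (P F))^-1%:E * x)).
  by rewrite PFE !muleA -EFinM mulVf ?mul1e// gt_eqF// fine_event_gt0.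
apply: cancelPF; rewrite mul_given (integral_given pF)//; last 2 first.
- exact: measurable_kernel.
- by move=> w; rewrite measure_ge0 kernel_le1.
have [_ ->//] := pk B mB.
by rewrite -setIA setIC.
Qed.

End conditioning_on_event.

Lemma cond_prob_exists dO (O : measurableType dO) (R : realType)
  (P : probability O R) dW (TW : measurableType dW) (W : {mfun O >-> TW})
  (E : set O) : measurable E -> exists g, is_cond_prob P W E g.
Proof.
move=> mE; have [PE0|PE] := eqVneq (P E) 0; last first.
  by eexists; exact: (is_cond_prob_Radon_Nikodym mE PE W).
(* A null event cannot be normalized, but 0 is a version of its conditional probability. *)
exists (cst 0); split => [|C mC]; first exact: integrable0.
rewrite integral0; apply/esym/eqP; rewrite -measure_le0 -PE0.
have mC' := measurable_preimage W mC.
by apply: le_measure; rewrite ?inE//; exact: measurableI.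
Qed.

(** * Disintegration of a joint law *)

Section disintegration.
Context dX dZ (TX : measurableType dX) (TZ : measurableType dZ) (R : realType).

Definition pair_left (z : TZ) : TX -> TX * TZ := fun x => (x, z).

HB.instance Definition _ z := isMeasurableFun.Build _ _ _ _ (pair_left z)
  (pair2_measurable z).

(* The [unit] factor only serves to match the type of the kernel composition
   [l \; k], applied below to a constant kernel [l]. *)
Definition kernel_graph (k : R.-pker TZ ~> TX) (z : unit * TZ) :
    {measure set (TX * TZ) -> \bar R} :=
  distribution (kernel_at k z.2) (pair_left z.2).

Let measurable_kernel_graph k U : measurable U ->
  measurable_fun [set: unit * TZ] (kernel_graph k ^~ U).
Proof.
move=> mU.
have mU' : measurable (@swap_pair TZ TX @^-1` U).
  by rewrite -[X in measurable X]setTI; exact: measurable_swap.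
have := measurable_fun_xsection_finite_kernel k (mem_set mU').
move=> /(fun h => measurableT_comp h (@measurable_snd _ _ unit TZ)).
apply: eq_measurable_fun => -[u z] _ /=.
rewrite /kernel_graph /distribution /pushforward /=; congr (k z _).
by apply/seteqP; split => x; rewrite /xsection /= inE.
Qed.

HB.instance Definition _ k := isKernel.Build _ _ _ _ R
  (kernel_graph k) (@measurable_kernel_graph k).

Let kernel_graph1 k z : kernel_graph k z setT = 1.
Proof. exact: probability_setT. Qed.

HB.instance Definition _ k := Kernel_isProbability.Build _ _ _ _ R
  (kernel_graph k) (@kernel_graph1 k).

Context dO (O : measurableType dO) (P : probability O R).
Context (X : {mfun O >-> TX}) (Z : {mfun O >-> TZ}) (k : R.-pker TZ ~> TX).
Hypothesis XZk : is_cond_law P X Z k.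

Lemma measurable_integral_kernel (f : TX * TZ -> \bar R) :
  measurable_fun setT f -> (forall u, 0 <= f u) ->
  measurable_fun setT (fun z => \int[k z]_x f (x, z)).
Proof.
move=> mf f0; apply: (measurable_fun_integral_finite_kernel (f \o @swap_pair TZ TX)).
  by move=> z; exact: f0.
by apply: measurableT_comp => //; exact: measurable_swap.
Qed.

(** The mixture [m] of the measures [kernel_graph k] over the law of [Z] agrees with the joint law
    on rectangles by [cond_lawP], hence on all measurable sets; the integral against a kernel
    composition is then an iterated integral. *)
Lemma cond_law_integral (f : TX * TZ -> \bar R) :
  measurable_fun setT f -> (forall u, 0 <= f u) ->
  \int[distribution P (rv_pair X Z)]_u f u =
  \int[distribution P Z]_z \int[k z]_x f (x, z).
Proof.
move=> mf f0.
pose l := kprobability (measurable_cst ((distribution P Z : probability TZ R) : pprobability TZ R))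
  : R.-pker unit ~> TZ.
pose m : {measure set (TX * TZ) -> \bar R} := (l \; kernel_graph k) tt.
have mX A B : measurable A -> measurable B ->
    m (A `*` B) = distribution P (rv_pair X Z) (A `*` B).
  move=> mA mB; rewrite -[RHS]((cond_lawP _ _ _ _).1 XZk A B mA mB).
  rewrite /m /= /mkcomp /kcomp /l /kprobability /= [RHS]integral_mkcond.
  apply: eq_integral => z _.
  rewrite /kernel_graph /distribution /pushforward /= patchE.
  case: ifPn => [|] zB.
    congr (k z _); apply/seteqP; split=> x //=; first by case.
    by split=> //; exact: set_mem.
  rewrite (_ : _ @^-1` _ = set0) ?measure0//; apply/seteqP; split => x //= [_].
  by move=> /mem_set; rewrite (negbTE zB).
have mE E : measurable E -> m E = distribution P (rv_pair X Z) E.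
  move=> mE; pose G := [set A `*` B | A in @measurable _ TX & B in @measurable _ TZ].
  apply: (measure_unique G (fun=> setT)) => //.
  - exact: measurable_prod_measurableType.
  - move=> _ _ [A mA [B mB <-]] [A' mA' [B' mB' <-]].
    exists (A `&` A'); first exact: measurableI.
    by exists (B `&` B'); [exact: measurableI|rewrite setXI].
  - by move=> _; exists setT => //; exists setT => //; rewrite setXTT.
  - by rewrite bigcup_const//; exists 0%N.
  - by move=> _ [A mA [B mB <-]]; exact: mX.
  - move=> _; rewrite -setXTT mX// (le_lt_trans (probability_le1 _ _)) ?ltry//.
    exact: measurableX.
rewrite (eq_measure_integral m) => [|A mA _]; last by rewrite mE.
rewrite integral_kcomp//.
apply: eq_integral => z _.
by rewrite ge0_integral_pushforward// => y _; exact: f0.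
Qed.

End disintegration.

(** * Calculus of conditional laws and uniqueness of the conditional mutual information *)

Section cond_law_theory.
Context dO (O : measurableType dO) (R : realType) (P : probability O R).

Lemma cond_law_unique dV dW (TV : measurableType dV) (TW : measurableType dW)
  (V : {mfun O >-> TV}) (W : {mfun O >-> TW}) (k k' : R.-pker TW ~> TV) :
  countably_generated TV -> is_cond_law P V W k -> is_cond_law P V W k' ->
  \forall w \ae distribution P W, forall B, measurable B -> k w B = k' w B.
Proof.
move=> cgV Vk Vk'.
apply: (@ae_eq_probability _ _ _ _ _ _ (kernel_at k) (kernel_at k')) => // B mB.
exact: cond_prob_unique (Vk B mB) (Vk' B mB).
Qed.

(** Disintegrating the indicator of a null set [N] shows that the sections of [N] have integral 0
    over [z], so almost all of them are null. *)
Lemma cond_law_ae dX dZ (TX : measurableType dX) (TZ : measurableType dZ)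
  (X : {mfun O >-> TX}) (Z : {mfun O >-> TZ}) (k : R.-pker TZ ~> TX)
  (A : TX * TZ -> Prop) : is_cond_law P X Z k ->
  (\forall u \ae distribution P (rv_pair X Z), A u) ->
  \forall z \ae distribution P Z, \forall x \ae k z, A (x, z).
Proof.
move=> Xk [N [mN N0 AN]].
have mf : measurable_fun setT (fun u => (\1_N u)%:E : \bar R).
  exact/measurable_EFinP/measurable_indic.
have f0 u : 0 <= (\1_N u)%:E :> \bar R by rewrite lee_fin.
have := cond_law_integral Xk mf f0; rewrite integral_indic// setIT => Ni.
have {Ni} := etrans (esym Ni) N0.
have i0 z : 0 <= \int[k z]_x (\1_N (x, z))%:E by exact: integral_ge0.
have mi := measurable_integral_kernel k mf f0.
under eq_integral do rewrite -(gee0_abs (i0 _)).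
move=> /(ae_eq_integral_abs _ measurableT mi); apply: filterS => z /(_ I) kN.
have mNz : measurable [set x | N (x, z)].
  exact: (measurable_preimage (pair_left z) mN).
exists [set x | N (x, z)]; split => //; last by move=> x; exact: AN.
apply: etrans kN; rewrite -[in LHS](setIT [set x | N (x, z)]) -integral_indic//.
Qed.

(** Law of total probability, by disintegrating the joint law of [X] and [Z]. *)
Lemma cond_law_bind dX dY dZ (TX : measurableType dX) (TY : measurableType dY)
  (TZ : measurableType dZ) (X : {mfun O >-> TX}) (Y : {mfun O >-> TY})
  (Z : {mfun O >-> TZ}) (kX : R.-pker TZ ~> TX)
  (kYX : R.-pker (TX * TZ)%type ~> TY) B : measurable B ->
  is_cond_law P X Z kX -> is_cond_law P Y (rv_pair X Z) kYX ->
  is_cond_prob P Z (Y @^-1` B) (fun z => \int[kX z]_x kYX (x, z) B).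
Proof.
move=> mB Xk Yk.
have mi := measurable_integral_kernel kX (measurable_kernel kYX B mB)
  (fun=> measure_ge0 _ _).
split.
  apply: probability_integrable_le1 => // z; rewrite integral_ge0//=.
  apply: (@le_trans _ _ (\int[kX z]_x cst 1 x)).
    apply: ge0_le_integral => //.
      exact: (measurableT_comp (measurable_kernel kYX B mB) (pair2_measurable z)).
    by move=> x _; exact: kernel_le1.
  by rewrite integral_cst// mul1e prob_kernel.
move=> C mC.
have mTC : measurable (setT `*` C : set (TX * TZ)) by exact: measurableX.
(* The indicator encodes the restriction to [C], as the disintegration formula integrates over the
   whole space. *)
pose f (u : TX * TZ) := kYX u B * (\1_(setT `*` C) u)%:E.
have mf : measurable_fun setT f.
  apply: emeasurable_funM; first exact: measurable_kernel.
  exact/measurable_EFinP/measurable_indic.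
have f0 u : 0 <= f u by rewrite mule_ge0// lee_fin.
have /cond_lawP/(_ B _ mB mTC) := Yk.
have -> : Y @^-1` B `&` rv_pair X Z @^-1` (setT `*` C) = Y @^-1` B `&` Z @^-1` C.
  by apply/seteqP; split => w [Yw Zw]; split => //; case: Zw.
move=> <-.
transitivity (\int[distribution P (rv_pair X Z)]_u f u).
  rewrite (cond_law_integral Xk mf f0) integral_mkcond; apply: eq_integral => z _.
  rewrite patchE /f; case: ifPn => zC.
    apply: eq_integral => x _; rewrite indicE mem_set ?mule1//.
    by split => //; exact: set_mem.
  rewrite integral0_eq// => x _; rewrite indicE memNset ?mule0//.
  by move=> -[_ /= /mem_set]; rewrite (negbTE zC).
rewrite [RHS]integral_mkcond; apply: eq_integral => u _.
rewrite patchE /f indicE; case: ifPn => _; first by rewrite mule1.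
by rewrite mule0.
Qed.

(** Since [r] recovers [W] from [W'], both variables carry the same events, and the law of [W'] is
    the image under [s] of that of [W]. *)
Lemma cond_law_precomp dV dW dW' (TV : measurableType dV)
  (TW : measurableType dW) (TW' : measurableType dW') (V : {mfun O >-> TV})
  (W : {mfun O >-> TW}) (W' : {mfun O >-> TW'}) (s : TW -> TW') (r : TW' -> TW)
  (ms : measurable_fun setT s) (k : R.-pker TW' ~> TV) :
  measurable_fun setT r -> cancel s r -> (forall w, W' w = s (W w)) ->
  is_cond_law P V W' k -> is_cond_law P V W (kernel_precomp k ms).
Proof.
move=> mr sK W'E /cond_lawP Vk; apply/cond_lawP => B C mB mC.
have mrC : measurable (r @^-1` C).
  by rewrite -[X in measurable X]setTI; exact: mr.
have := Vk B _ mB mrC.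
have -> : W' @^-1` (r @^-1` C) = W @^-1` C.
  by apply/seteqP; split => w /=; rewrite W'E sK.
move=> <-; rewrite [RHS](eq_measure_integral (pushforward (distribution P W) s)).
  rewrite [RHS]ge0_integral_pushforward//.
  - rewrite (_ : s @^-1` _ = C)//.
    by apply/seteqP; split => w /=; rewrite sK.
  - by apply: measurable_funTS; exact: measurable_kernel.
move=> A mA _; rewrite /distribution /pushforward; congr (P _).
by apply/seteqP; split => w /=; rewrite W'E.
Qed.

Lemma cond_law_map dV dV' dW (TV : measurableType dV) (TV' : measurableType dV')
  (TW : measurableType dW) (V : {mfun O >-> TV}) (V' : {mfun O >-> TV'})
  (W : {mfun O >-> TW}) (phi : {mfun TV >-> TV'}) (k : R.-pker TW ~> TV) :
  (forall w, V' w = phi (V w)) ->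
  is_cond_law P V W k -> is_cond_law P V' W (kernel_map k phi).
Proof.
move=> V'E /cond_lawP Vk; apply/cond_lawP => B C mB mC.
have -> : V' @^-1` B = V @^-1` (phi @^-1` B).
  by apply/seteqP; split => w /=; rewrite V'E.
exact: (Vk _ _ (measurable_preimage phi mB) mC).
Qed.

End cond_law_theory.

(* The map [phi] accounts for the feature [Some X] carrying the same information
   as [X]. *)
Lemma cond_mutual_info_unique (R : realType)
  dO (O : measurableType dO) (P : probability O R)
  dO' (O' : measurableType dO') (P' : probability O' R)
  dX dX' dY dZ (TX : measurableType dX) (TX' : measurableType dX')
  (TY : measurableType dY) (TZ : measurableType dZ)
  (X : {mfun O >-> TX}) (phiX : {mfun O >-> TX'}) (Y : {mfun O >-> TY})
  (Z : {mfun O >-> TZ})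
  (X' : {mfun O' >-> TX'}) (Y' : {mfun O' >-> TY}) (Z' : {mfun O' >-> TZ})
  (phi : {mfun TX >-> TX'}) (psi : TX' -> TX) I I' :
  countably_generated TX' -> countably_generated TY ->
  measurable_fun setT psi -> cancel phi psi -> measurable (range phi) ->
  (forall w, phiX w = phi (X w)) ->
  (forall E, measurable E ->
    distribution P (rv_pair Y (rv_pair phiX Z)) E =
    distribution P' (rv_pair Y' (rv_pair X' Z')) E) ->
  is_cond_mutual_info P Y X Z I -> is_cond_mutual_info P' Y' X' Z' I' ->
  \forall z \ae distribution P Z, I z = I' z.
Proof.
move=> cgX' cgY mpsi phiK mrange phiXE PP'.
move=> [kX [kYX [kY [Xk YXk Yk IE]]]] [kX' [kYX' [kY' [Xk' YXk' Yk' IE']]]].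
(* The three kernels of the second space are first read as conditional laws under [P], where they
   can be compared with the others. *)
have {}Xk' : is_cond_law P phiX Z kX'.
  apply: cond_law_transfer Xk' => E mE.
  apply: (PP' (snd @^-1` E)).
  by rewrite -[X in measurable X]setTI; exact: measurable_snd.
have {}Yk' : is_cond_law P Y Z kY'.
  apply: cond_law_transfer Yk' => E mE.
  apply: (PP' ((fun u => (u.1, u.2.2)) @^-1` E)).
  rewrite -[X in measurable X]setTI.
  have mf : measurable_fun setT (fun u : TY * (TX' * TZ) => (u.1, u.2.2)).
    apply: measurable_fun_pair => //.
    exact: (measurableT_comp measurable_snd measurable_snd).
  exact: mf.
have {}YXk' : is_cond_law P Y (rv_pair phiX Z) kYX'.
  exact: cond_law_transfer YXk'.
have ms : measurable_fun setT (fun u : TX * TZ => (phi u.1, u.2)).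
  by apply: measurable_fun_pair => //; exact: measurableT_comp.
have mr : measurable_fun setT (fun u : TX' * TZ => (psi u.1, u.2)).
  by apply: measurable_fun_pair => //; exact: measurableT_comp.
have {}YXk' : is_cond_law P Y (rv_pair X Z) (kernel_precomp kYX' ms).
  apply: (@cond_law_precomp _ _ _ P _ _ _ _ _ _ Y (rv_pair X Z)
    (rv_pair phiX Z) _ _ ms kYX' mr) => [[x z]|w|//] /=; first by rewrite phiK.
  by rewrite /rv_pair phiXE.
have {}Xk'' := cond_law_map phiXE Xk.
have XE := cond_law_unique cgX' Xk' Xk''.
have YE := cond_law_unique cgY Yk Yk'.
have YXE := cond_law_ae Xk (cond_law_unique cgY YXk YXk').
apply: filterS3 XE YE YXE => z Xz Yz YXz.
rewrite IE IE'.
apply: (@ae_integral_transfer _ _ _ _ _ (kernel_at kX z) (kernel_at kX' z) phi psi) => //.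
apply: filterS YXz => x YXz.
by apply: eq_kl_divergence.
Qed.

(** * Kernels that remain conditional laws after conditioning on an event *)

Lemma is_cond_prob_ae dO (O : measurableType dO) (R : realType)
  (P : probability O R) dW (TW : measurableType dW) (W : {mfun O >-> TW}) E g h :
  is_cond_prob P W E g -> measurable_fun setT h ->
  (\forall w \ae distribution P W, g w = h w) -> is_cond_prob P W E h.
Proof.
move=> [ig gE] mh gh; have mg := measurable_int _ ig.
have gh' : ae_eq (distribution P W) setT g h by apply: filterS gh.
split; last first.
  move=> C mC; rewrite -gE//; apply: ae_eq_integral => //.
  - exact: measurable_funTS.
  - exact: measurable_funTS.
  - by apply: filterS gh => w ->.
apply/integrableP; split => //; move/integrableP: ig => [_]; apply: le_lt_trans.
rewrite le_eqVlt; apply/orP; left; apply/eqP; apply: ae_eq_integral => //.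
- exact: measurableT_comp.
- exact: measurableT_comp.
- by apply: filterS gh => w ->.
Qed.

Section cond_law_given_event.
Context dO (O : measurableType dO) (R : realType) (P : probability O R).

(** Conditional independence factors the conditional probability of the joint event as
    [cond_law_given] demands. As [cond_indep] quantifies over versions, versions must first be shown
    to exist. *)
Lemma cond_indep_cond_law dU dV dW (TU : measurableType dU)
  (TV : measurableType dV) (TW : measurableType dW) (U : {mfun O >-> TU})
  (V : {mfun O >-> TV}) (W : {mfun O >-> TW}) (k : R.-pker TW ~> TV) A
  (mA : measurable (U @^-1` A)) (PA : P (U @^-1` A) != 0) : measurable A ->
  cond_indep P U V W -> is_cond_law P V W k ->
  is_cond_law (given P mA) V W k.
Proof.
move=> mA' UVW Vk.
have [p pA] := cond_prob_exists P W mA.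
apply: (cond_law_given mA PA pA) => B mB.
have [g gAB] := cond_prob_exists P W (measurableI _ _ mA (measurable_preimage V mB)).
apply: (is_cond_prob_ae gAB); last exact: (UVW A B mA' mB _ _ _ pA (Vk B mB) gAB).
apply: emeasurable_funM; last exact: measurable_kernel.
by case: pA => /measurable_int.
Qed.

(** An event determined by [W] has an indicator as conditional probability given [W], and
    multiplying by it only restricts the domain of integration. *)
Lemma cond_law_given_preimage dV dW (TV : measurableType dV)
  (TW : measurableType dW) (V : {mfun O >-> TV}) (W : {mfun O >-> TW})
  (k : R.-pker TW ~> TV) F (mF : measurable F) (PF : P F != 0) D :
  measurable D -> F = W @^-1` D ->
  is_cond_law P V W k -> is_cond_law (given P mF) V W k.
Proof.
move=> mD FE /cond_lawP Vk.
have mp : measurable_fun setT (fun w => (\1_D w)%:E : \bar R).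
  exact/measurable_EFinP/measurable_indic.
have p01 w : 0 <= ((\1_D w)%:E : \bar R) <= 1.
  by rewrite indicE; case: (w \in D); rewrite !lee_fin ?ler01 lexx.
have pf (f : TW -> \bar R) C :
    \int[distribution P W]_(w in C) ((\1_D w)%:E * f w) =
    \int[distribution P W]_(w in C `&` D) f w.
  rewrite integral_mkcondr; apply: eq_integral => w _; rewrite indicE patchE.
  by case: ifPn => _; rewrite ?mul1e ?mul0e.
have pF : is_cond_prob P W F (fun w => (\1_D w)%:E).
  split; first exact: probability_integrable_le1.
  by move=> C mC; rewrite integral_indic// FE.
apply: (cond_law_given mF PF pF) => B mB; split.
  apply: probability_integrable_le1 => //.
    by apply: emeasurable_funM => //; exact: measurable_kernel.
  move=> w; have /andP[p0 p1] := p01 w; rewrite mule_ge0//=.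
  by rewrite -[leRHS]mule1 lee_pmul// kernel_le1.
move=> C mC; rewrite pf Vk//; last exact: measurableI.
by rewrite preimage_setI FE setIA setIC setIA.
Qed.

End cond_law_given_event.

(** * Information under the law conditioned on the feature being observed *)

Section option_maps.
Context d (T : measurableType d).

Lemma measurable_Some : measurable_fun [set: T] (@Some T).
Proof. by move=> _ B mB; rewrite setTI. Qed.

HB.instance Definition _ := isMeasurableFun.Build _ _ _ _ (@Some T) measurable_Some.

Lemma measurable_odflt (x : T) : measurable_fun [set: option T] (odflt x).
Proof. by move=> _ B mB; rewrite setTI. Qed.

Lemma measurable_range_Some : measurable (range (@Some T)).
Proof.
rewrite /measurable/= /option_measurable/= (_ : _ @^-1` _ = setT)//.
by apply/seteqP; split => // x _; exists x.
Qed.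

End option_maps.

Section missing_feature.
Context dO (O : measurableType dO) (R : realType) (P : probability O R).
Context dX dY dZ (TX : measurableType dX) (TY : measurableType dY)
  (TZ : measurableType dZ).
Context (X : {mfun O >-> TX}) (Y : {mfun O >-> TY}) (Z : {mfun O >-> TZ})
  (b : {mfun O >-> bool}).

Let F := b @^-1` [set true].
Let mF : measurable F. Proof. exact: measurable_preimage. Qed.

Hypothesis b_pos : forall g, is_cond_prob P Z F g ->
  \forall z \ae distribution P Z, 0 < g z.

(** The probability assumed null is the integral over [N] of an almost everywhere positive function,
    which forces [N] to be null. *)
Lemma positivity_null N : measurable N -> P (F `&` Z @^-1` N) = 0 ->
  distribution P Z N = 0.
Proof.
move=> mN PN0; have [g gF] := cond_prob_exists P Z mF.
have g_pos := b_pos gF; case: gF => ig gE.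
have mg := measurable_int _ ig.
have := gE N mN; rewrite PN0 (@ae_eq_integral _ _ _ _ _ (abse \o g))//; last 3 first.
- exact: measurable_funTS.
- by apply: measurable_funTS; exact: measurableT_comp.
- by apply: filterS g_pos => z /ltW gz _ /=; rewrite gee0_abs.
move=> /(ae_eq_integral_abs _ mN (measurable_funTS mg)) g0.
apply: ((negligibleP (distribution P Z) mN).1 _).
rewrite -[N]setCK; change (\forall z \ae distribution P Z, ~ N z).
by apply: filterS2 g_pos g0 => z gz + Nz => /(_ Nz) gz0; rewrite gz0 ltxx in gz.
Qed.

Lemma observed_event_neq0 : P F != 0.
Proof.
apply/eqP => PF0; have := positivity_null measurableT.
rewrite preimage_setT setIT => /(_ PF0); rewrite probability_setT => /eqP.
by rewrite onee_eq0.
Qed.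

Let Q : probability O R := given P mF.
Let PF := observed_event_neq0.

(** Converse of [given_dominates], and the place where positivity brings a conclusion under [Q] back
    to [P]. *)
Lemma given_observed_ae A :
  (\forall z \ae distribution Q Z, A z) -> \forall z \ae distribution P Z, A z.
Proof.
move=> [N [mN QN AN]]; exists N; split => //; apply: positivity_null => //.
rewrite setIC -(mul_given mF PF).
by apply/eqP; rewrite mule_eq0; apply/orP; right; apply/eqP.
Qed.

Lemma eq_given (E1 E2 : set O) : E1 `&` F = E2 `&` F -> Q E1 = Q E2.
Proof. by move=> E12; rewrite /Q/= !givenE// E12. Qed.

(** The same three kernels serve under [Q]. Independence of [b] and [Y] given [Z] alone is not
    assumed, so [kY] has to be reached through the other two. *)
Lemma cond_mutual_info_given_observed I :
  cond_indep P b X Z -> cond_indep P b Y (rv_pair X Z) ->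
  is_cond_mutual_info P Y X Z I -> is_cond_mutual_info Q Y X Z I.
Proof.
move=> bX bY [kX [kYX [kY [Xk YXk Yk IE]]]]; exists kX, kYX, kY.
have Xk' : is_cond_law Q X Z kX by exact: cond_indep_cond_law bX Xk.
have YXk' : is_cond_law Q Y (rv_pair X Z) kYX by exact: cond_indep_cond_law bY YXk.
split => // B mB.
have mk := measurable_kernel kY B mB.
apply: (is_cond_prob_ae (cond_law_bind mB Xk' YXk')) => //.
(* [kY] is the mixture of [kYX] under [kX], for [P] hence also for [Q]. *)
have [N [mN N0 H]] := cond_prob_unique (cond_law_bind mB Xk YXk) (Yk B mB).
exists N; split => //.
have /null_content_dominatesP QZ : distribution Q Z `<< distribution P Z.
  exact: given_dominates.
exact: QZ.
Qed.

(** The event [F] is determined by [b], so the kernels given [rv_pair Z b] stay valid under [Q];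
    there [b] is almost surely [true], and pairing [Z] with a constant adds no information. *)
Lemma cond_mutual_info_given_missing (X' : {mfun O >-> option TX}) I :
  is_cond_mutual_info P Y X' (rv_pair Z b) I ->
  is_cond_mutual_info Q Y X' Z (fun z => I (z, true)).
Proof.
move=> [kX [kYX [kY [Xk YXk Yk IE]]]].
pose bt : {mfun O >-> bool} := cst true.
have mbt : measurable_fun setT (fun z : TZ => (z, true)).
  by apply: measurable_fun_pair.
have mbt' : measurable_fun setT (fun u : option TX * TZ => (u.1, (u.2, true))).
  by apply: measurable_fun_pair => //; apply: measurable_fun_pair.
have mD : measurable (snd @^-1` [set true] : set (TZ * bool)).
  by rewrite -[X in measurable X]setTI; exact: measurable_snd.
have mD' : measurable ((fun u => u.2.2) @^-1` [set true] : set (option TX * (TZ * bool))).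
  rewrite -[X in measurable X]setTI.
  have ms : measurable_fun setT (fun u : option TX * (TZ * bool) => u.2.2).
    exact: (measurableT_comp measurable_snd measurable_snd).
  exact: ms.
have toQ dV (TV : measurableType dV) (V : {mfun O >-> TV}) (k : R.-pker TZ * bool ~> TV) :
    is_cond_law P V (rv_pair Z b) k -> is_cond_law Q V Z (kernel_precomp k mbt).
  move=> Vk.
  apply: (@cond_law_precomp _ _ _ Q _ _ _ _ _ _ V Z (rv_pair Z bt) _ fst) => //.
  (* Replacing [b] by the constant [bt] keeps the joint law under [Q], since the two agree on
     [F]. *)
  apply: cond_law_transfer (cond_law_given_preimage mF PF mD _ Vk) => // E mE.
  have bE w : F w -> E (V w, (Z w, true)) <-> E (V w, (Z w, b w)) by move=> ->.
  by apply: eq_given; apply/seteqP; split => w [Ew Fw]; split => //;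
    [apply/(bE w Fw).1|apply/(bE w Fw).2].
exists (kernel_precomp kX mbt), (kernel_precomp kYX mbt'), (kernel_precomp kY mbt).
split.
- exact: toQ.
- apply: (@cond_law_precomp _ _ _ Q _ _ _ _ _ _ Y (rv_pair X' Z)
    (rv_pair X' (rv_pair Z bt)) _ (fun u => (u.1, u.2.1))) => //.
  + apply: measurable_fun_pair => //.
    exact: (measurableT_comp measurable_fst measurable_snd).
  + by case.
  + apply: cond_law_transfer (cond_law_given_preimage mF PF mD' _ YXk) => // E mE.
    have bE w : F w -> E (Y w, (X' w, (Z w, true))) <-> E (Y w, (X' w, (Z w, b w))).
      by move=> ->.
    by apply: eq_given; apply/seteqP; split => w [Ew Fw]; split => //;
      [apply/(bE w Fw).1|apply/(bE w Fw).2].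
- exact: toQ.
- move=> z; rewrite IE; apply: eq_integral => x _.
  (* The measures on both sides have the same values but are packaged from different kernels. *)
  exact: eq_kl_divergence.
Qed.

End missing_feature.

(** * Identification and the observed-data formula *)

Lemma measurable_dprod_proj (I : Type) (d : I -> measure_display)
  (T : forall i, measurableType (d i)) i :
  measurable_fun [set: dprod T] (fun f => f i).
Proof.
move=> _ B mB; apply: sub_sigma_algebra; exists i => //.
by exists B.
Qed.

Theorem theorem3p4 (R : realType) (n : nat)
  (dT : 'I_n -> measure_display) (T : forall k, measurableType (dT k))
  (dY : measure_display) (TY : measurableType dY)
  (cgT : forall k, countably_generated (T k))
  (cgY : countably_generated TY) :
  (forall M : task R T TY -> Prop,
     identified M same_reference_law ->
     forall (A : {set 'I_n}) (j : 'I_n),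
       identified M (same_potential_cmi A j)) /\
  (forall (tau : task R T TY) (A : {set 'I_n}) (j : 'I_n),
     missing_at_random tau A j ->
     no_direct_effect tau A j ->
     positivity tau A ->
     forall I I', potential_cmi tau A j I -> observed_cmi tau A j I' ->
       \forall x \ae distribution (task_law tau) (acquired tau A),
         I x = I' (x, true)).
Proof.
split=> [M idM A j tau tau' Mtau Mtau' obs I I' HI HI'|].
  have ref := idM tau tau' Mtau Mtau' obs.
  (* Both informations here concern the potential feature itself, so the embedding [phi] is the
     identity. *)
  pose idm : {mfun T j >-> T j} :=
    HB.pack (fun x : T j => x) (isMeasurableFun.Build _ _ _ _ _ (@measurable_id _ (T j) setT)).
  apply: (cond_mutual_info_unique (phiX := potential tau j) (phi := idm)
    (psi := id) _ _ _ _ _ _ _ HI HI') => //.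
    by rewrite /= image_id.
  move=> E mE.
  (* The target, the candidate and the acquired features are a measurable function of the reference
     data, so their joint law is determined by the reference law. *)
  pose h (u : dprod T * TY) : TY * (T j * dprod (fun k : {k | k \in A} => T (val k))) :=
    (u.2, (u.1 j, fun k => u.1 (val k))).
  have mh : measurable_fun setT h.
    apply: measurable_fun_pair => //; apply: measurable_fun_pair.
      apply: (measurableT_comp (f := fun f : dprod T => f j)); last exact: measurable_fst.
      exact: measurable_dprod_proj.
    apply: measurable_dprodP => k.
    apply: (measurableT_comp (f := fun f : dprod T => f (val k))); last exact: measurable_fst.
    exact: measurable_dprod_proj.
  apply: (ref (h @^-1` E)).
  by rewrite -[X in measurable X]setTI; exact: mh.
move=> tau A j mar nde pos I I' HI HI'.
have pos_j := pos j.
(* By positivity it suffices to argue almost everywhere under the law conditioned on [j] being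
   observed. *)
apply: (given_observed_ae pos_j).
(* The potential feature is moved to the value space of the realized one; [odflt point] is a left
   inverse of [Some], with [point] as its value at [None]. *)
pose X1 w := Some (potential tau j w).
have mX1 : measurable_fun setT X1 by apply: measurableT_comp => //; exact: measurable_Some.
pose X1m : {mfun task_space tau >-> option (T j)} :=
  HB.pack X1 (isMeasurableFun.Build _ _ _ _ _ mX1).
apply: (cond_mutual_info_unique (phiX := X1m) (phi := @Some (T j)) (psi := odflt point)
  _ _ _ _ _ _ _ (cond_mutual_info_given_observed pos_j mar nde HI)
  (cond_mutual_info_given_missing pos_j HI')) => //.
- exact: countably_generated_option.
- exact: measurable_odflt.
- exact: measurable_range_Some.
- move=> E mE; apply: (eq_given pos_j).
  (* On the conditioning event [X1] and the realized feature coincide, hence the two triples have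
     the same conditional law. *)
  have bE w : observed tau j w = true ->
      E (target tau w, (X1 w, acquired tau A w)) <->
      E (target tau w, (realized j w, acquired tau A w)).
    by rewrite /realized => ->.
  by apply/seteqP; split => w [Ew Fw]; split => //;
    [apply/(bE w Fw).1|apply/(bE w Fw).2].
Qed.
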